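(* Let $p$ be a prime with $p \equiv 3 \pmod 4$, and let \[ f_p(x) = \frac{x^p - x}{p} + x^{(p+1)/2} + 1 \in \mathbb{Q}[x]. \] Then $f_p(x)$ is irreducible in $\mathbb{Q}[x]$.
   Context: For prime $p$, $f_p$ is integer-valued, i.e. $f_p(k)\in\mathbb{Z}$ for all $k\in\mathbb{Z}$. *)

(* Defs.v *)
From HB Require Import structures.
From mathcomp Require Import all_boot all_order all_algebra.
Set Implicit Arguments.
Unset Strict Implicit.
Unset Printing Implicit Defensive.
Import Order.TTheory GRing.Theory Num.Theory.
Local Open Scope ring_scope.

Definition fp (p : nat) : {poly rat} :=
  p%:R^-1 *: ('X^p - 'X) + 'X^((p + 1) %/ 2) + 1.

(* Main.v *)
Require Import Defs.
From HB Require Import structures.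
From mathcomp Require Import all_boot all_order all_algebra.
From mathcomp Require Import all_field zify ring.
Import Order.TTheory GRing.Theory Num.Theory.
Local Open Scope ring_scope.
Set Implicit Arguments.
Unset Strict Implicit.
Unset Printing Implicit Defensive.

(** Write [p = 2m+1] and [F = p f_p = X^p + p X^(m+1) - X + p], and denote by
    [q*] the reciprocal of a polynomial [q].  If [F = g h] over the integers,
    then one of the factors, say [g], has constant term [1] or [-1].  As in
    Ljunggren's method, [H = g* h] satisfies [H H* = F F*], that is, [H] and [F]
    have the same autocorrelations.  The constant term [p] and the middle
    coefficient [p] use up almost all of the squared norm [2p^2+2], and this
    forces [H = F] or [H = -F].  Hence [g* = g] or [g* = -g], so [g] divides [F*]
    and also [X F* + F = p (X^(m+1) + 1)^2].  A complex root [x] of [g] would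
    satisfy [x^(m+1) = -1] and [x^(2m) = 1], hence [x^2 = 1], which is absurd
    because [m+1] is even. *)

(** * Finite sums *)

Lemma sum_ord_support (R : nmodType) (N : nat) (s : seq nat) (u : nat -> R) :
    uniq s -> all (gtn N) s ->
    (forall i, (i < N)%N -> i \notin s -> u i = 0) ->
  \sum_(i < N) u i = \sum_(i <- s) u i.
Proof.
move=> s_uniq s_lt u0; rewrite -(big_mkord xpredT u) /index_iota subn0.
rewrite (bigID (mem s)) /= [X in _ + X]big1_seq ?addr0; last first.
  by move=> i /andP[i_s]; rewrite mem_iota add0n => /andP[_ i_lt]; exact: u0.
rewrite -big_filter; apply: perm_big.
apply: uniq_perm => //; first exact/filter_uniq/iota_uniq.
move=> i; rewrite mem_filter mem_iota add0n /=.
by case: (boolP (i \in s)) => //= /(allP s_lt).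
Qed.

Lemma ler_sum_ord_seq (R : numDomainType) (N : nat) (s : seq nat)
    (u : nat -> R) :
    uniq s -> all (gtn N) s -> (forall i, 0 <= u i) ->
  \sum_(i <- s) u i <= \sum_(i < N) u i.
Proof.
move=> s_uniq s_lt u_ge0.
have -> : \sum_(i <- s) u i = \sum_(i <- s) (if i \in s then u i else 0).
  by rewrite !big_seq; apply: eq_bigr => i ->.
rewrite -(sum_ord_support s_uniq s_lt); last by move=> i _ /negbTE->.
by apply: ler_sum => i _; case: ifP.
Qed.

(** * Reciprocal polynomials *)

Section Reciprocal.
Variable R : comNzRingType.
Implicit Types p q : {poly R}.

(* The reciprocal [X^d p(1/X)] of a polynomial [p] of degree at most [d]. *)
Definition recip (d : nat) p : {poly R} := \poly_(i < d.+1) p`_(d - i).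

Lemma coef_recip d p i :
  (recip d p)`_i = if (i <= d)%N then p`_(d - i) else 0.
Proof. by rewrite coef_poly ltnS. Qed.

Lemma size_recip d p : (size (recip d p) <= d.+1)%N.
Proof. exact: size_poly. Qed.

Lemma recipK d p : (size p <= d.+1)%N -> recip d (recip d p) = p.
Proof.
move=> sp; apply/polyP => i; rewrite !coef_recip leq_subr.
case: leqP => [le_id|di]; first by rewrite subKn.
by rewrite nth_default //; apply: leq_trans sp di.
Qed.

Lemma recipD d p q : recip d (p + q) = recip d p + recip d q.
Proof.
apply/polyP => i; rewrite coefD !coef_recip coefD.
by case: ifP; rewrite ?addr0.
Qed.

Lemma recipZ d c p : recip d (c *: p) = c *: recip d p.
Proof.
apply/polyP => i; rewrite coefZ !coef_recip coefZ.
by case: ifP; rewrite ?mulr0.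
Qed.

Lemma recipMX d p : recip d.+1 (p * 'X) = recip d p.
Proof.
apply/polyP => i; rewrite !coef_recip coefMX subn_eq0.
case: (ltngtP i d.+1) => [|lt_di|->]; last by rewrite ltnn.
  by rewrite ltnS => le_id; rewrite le_id subSn.
by rewrite leqNgt (ltnW lt_di).
Qed.

Lemma recipXn d k : (k <= d)%N -> recip d 'X^k = 'X^(d - k).
Proof.
move=> le_kd; apply/polyP => i; rewrite coef_recip !coefXn.
case: leqP => [le_id|lt_di]; first by congr (_ %:R); lia.
by rewrite (_ : (i == d - k)%N = false) //; lia.
Qed.

Lemma recip_addl k d q :
  (size q <= d.+1)%N -> recip (k + d) q = 'X^k * recip d q.
Proof.
move=> sq; apply/polyP => i; rewrite coefXnM !coef_recip.
case: ltnP => [ik|ki].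
  by case: ifP => // _; rewrite nth_default //; apply: leq_trans sq _; lia.
by rewrite leq_subLR; case: ifP => // _; congr (q`_ _); lia.
Qed.

(** Only degree bounds are assumed, so the induction on [a] can write [p] as [p' * 'X + c]:
    [recipMX] absorbs the factor ['X], and the constant contributes [c *: 'X^(a.+1)] times the
    reciprocal of [q]. *)
Lemma recipM a b p q : (size p <= a.+1)%N -> (size q <= b.+1)%N ->
  recip (a + b) (p * q) = recip a p * recip b q.
Proof.
move=> sp sq; elim: a p sp => [p sp|a IHa].
  rewrite (size1_polyC sp) mul_polyC recipZ.
  suff -> : recip 0 (p`_0)%:P = (p`_0)%:P :> {poly R} by rewrite mul_polyC.
  by apply/polyP => i; rewrite coef_recip !coefC; case: i.
have recipC c : recip a.+1 c%:P = c *: 'X^(a.+1) :> {poly R}.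
  apply/polyP => i; rewrite coef_recip coefZ coefXn coefC subn_eq0.
  by case: (ltngtP i a.+1); rewrite ?mulr1 ?mulr0.
have recip0 d : recip d 0 = 0 :> {poly R}.
  by rewrite -(scale0r (0 : {poly R})) recipZ !scale0r.
elim/poly_ind=> [|p c _ sp]; first by rewrite mul0r !recip0 mul0r.
have {}sp : (size p <= a.+1)%N.
  move: sp; rewrite size_MXaddC; case: ifP => [/andP[/eqP-> _]|//].
  by rewrite size_poly0.
rewrite mulrDl mulrAC !recipD addSn !recipMX IHa // mulrDl; congr (_ + _).
by rewrite mul_polyC recipZ -addSn recip_addl // recipC -scalerAl.
Qed.

End Reciprocal.

(** * Autocorrelations *)

Definition autocorr (N : nat) (u : nat -> int) (k : nat) : int :=
  \sum_(i < N) u i * u (i + k)%N.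

(** In the convolution, [q]_i[meets the reciprocal at index]n - k - i[, which is]q[_(i + k)]; the
    terms with [i > n - k] vanish by the degree bound. *)
Lemma coef_mul_recip (n k : nat) (q : {poly int}) :
    (size q <= n.+1)%N -> (k <= n)%N ->
  (q * recip n q)`_(n - k) = autocorr n.+1 (fun i => q`_i) k.
Proof.
move=> sq le_kn; rewrite coefM /autocorr.
pose u i := q`_i * q`_(i + k).
rewrite (@sum_ord_support _ _ (iota 0 (n - k).+1) u) ?iota_uniq //.
- rewrite -[(n - k).+1 in RHS]subn0 -/(index_iota 0 _) big_mkord.
  apply: eq_bigr => -[i /= lt_i] _; rewrite coef_recip ifT; last by lia.
  by congr (_ * q`_ _); lia.
- by apply/allP => i; rewrite mem_iota /=; lia.
move=> i lt_in; rewrite mem_iota /u => i_nk.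
by rewrite [q`_(i + k)]nth_default ?mulr0 //; apply: leq_trans sq _; lia.
Qed.

Lemma autocorr_support (N : nat) (s : seq nat) (u : nat -> int) (k : nat) :
    uniq s -> all (gtn N) s ->
    (forall i, (i < N)%N -> i \notin s -> u (i + k)%N = 0) ->
  autocorr N u k = \sum_(i <- s) u i * u (i + k)%N.
Proof.
move=> s_uniq s_lt u0.
apply: (sum_ord_support (u := fun i => u i * u (i + k)%N)) => // i lt_iN i_s.
by rewrite u0 ?mulr0.
Qed.

(* The prescribed values are the autocorrelations of [F], and the conclusion
   lists its coefficients. *)
Lemma autocorr_rigidity (m : nat) (u : nat -> int) :
    let n := m.*2.+1 in
    (1 < m)%N -> u 0%N = n%:Z -> u n = 1 ->
    (forall i, (n < i)%N -> u i = 0) ->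
    autocorr n.+1 u 0 = 2 * n%:Z ^+ 2 + 2 ->
    autocorr n.+1 u m.+1 = n%:Z ^+ 2 ->
    autocorr n.+1 u m.*2 = -1 ->
    (forall k, (m.+1 < k < m.*2)%N -> autocorr n.+1 u k = 0) ->
  [/\ u 1%N = -1, u m.+1 = n%:Z &
      forall i, i \notin [:: 0; 1; m.+1; n]%N -> u i = 0].
Proof.
move=> n m_gt1 u0 un u_gt A0 Am A2m Ak; set P : int := n%:Z in u0 A0 Am *.
have P_ge5 : 5 <= P by rewrite /P /n; lia.
clearbody P.
have sq_ge0 i : 0 <= u i * u i by rewrite -expr2 sqr_ge0.
have A0E : \sum_(i < n.+1) u i * u i = 2 * P ^+ 2 + 2.
  by rewrite -A0; apply: eq_bigr => i _; rewrite addn0.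
have sq_le (s : seq nat) : uniq s -> all (gtn n.+1) s ->
    \sum_(i <- s) u i * u i <= 2 * P ^+ 2 + 2.
  by move=> s_uniq s_lt; rewrite -A0E (ler_sum_ord_seq (u := fun i => u i * u i)).
(* [sum_(i <= m) (u_i - u_(i+m+1))^2 = A_0 - 2 A_(m+1) = 2]. *)
have mid : (P - u m.+1) ^+ 2 <= 2.
  have nE : n.+1 = (m.+1 + m.+1)%N by rewrite /n; lia.
  have A0s : \sum_(i < m.+1) u i * u i
      + \sum_(i < m.+1) u (m.+1 + i)%N * u (m.+1 + i)%N = 2 * P ^+ 2 + 2.
    by rewrite -A0E nE big_split_ord.
  have Ams : \sum_(i < m.+1) u i * u (m.+1 + i)%N = P ^+ 2.
    rewrite -Am /autocorr nE big_split_ord /= [X in _ = _ + X]big1 ?addr0.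
      by apply: eq_bigr => i _; rewrite addnC.
    by move=> i _; rewrite [u (_ + m.+1)%N]u_gt ?mulr0 // nE; lia.
  pose d i := (u i - u (m.+1 + i)%N) ^+ 2.
  have dE : \sum_(i < m.+1) d i = 2.
    transitivity (\sum_(i < m.+1) (u i * u i + u (m.+1 + i)%N * u (m.+1 + i)%N
        + (- 2) * (u i * u (m.+1 + i)%N))).
      by apply: eq_bigr => i _; rewrite /d; ring.
    by rewrite !big_split -mulr_sumr /= A0s Ams; ring.
  have := @ler_sum_ord_seq _ m.+1 [:: 0%N] d isT isT (fun i => sqr_ge0 _).
  by rewrite dE big_seq1 /d u0 addn0.
(* An integer whose square is at most 2 lies in {-1, 0, 1}. With [u_0 = P] and [u_n = 1], the other
   squares then sum to at most [P^2 + 1 - (P - 1)^2 = 2P]. *)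
have mid_ge : P - 1 <= u m.+1 by nia.
have mid_sq : P ^+ 2 - 2 * P + 1 <= u m.+1 * u m.+1 by nia.
(* [A_(2m) = -1] reads [P u_(2m) + u_1 = -1]. If [u_(2m)] were nonzero, then [|u_1| >= P - 1], while
   [u_1^2 <= 2P]: impossible for [P >= 5]. *)
have [u1 u2m] : u 1%N = -1 /\ u m.*2 = 0.
  have := sq_le [:: 0; 1; m.+1; n]%N; rewrite !big_cons big_nil u0 un.
  move=> /(_ _ _)/wrap[|| sq]; [by rewrite /= ?inE /n; lia..|].
  move: A2m; rewrite (@autocorr_support _ [:: 0; 1]%N) //=.
  - rewrite !big_cons big_nil add0n u0 add1n un => A2m.
    have c0 : u m.*2 = 0.
      have u1E : u 1%N = - 1 - P * u m.*2 by lia.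
      move: sq; rewrite u1E => sq.
      set c := u m.*2 in sq *.
      by case: (ltgtP c 0) => [c_lt0|c_gt0|//]; nia.
    by split=> //; lia.
  by move=> i lt_in; rewrite !inE => i_s; rewrite u_gt // /n; lia.
(* By induction and [u_(2m) = 0], only the two extreme terms of [A_(n-l) = 0] survive:
   [P u_(n-l) + u_l = 0]. A nonzero [u_(n-l)] would give [u_l^2 >= P^2 > 2P]. *)
have tails l : (1 < l < m)%N -> u l = 0 /\ u (n - l)%N = 0.
  elim/ltn_ind: l => l IHl l_m.
  have := sq_le [:: 0; l; m.+1; n]%N; rewrite !big_cons big_nil u0 un.
  move=> /(_ _ _)/wrap[|| sq]; [by rewrite /= ?inE /n; lia..|].
  have := Ak (n - l)%N; rewrite (@autocorr_support _ [:: 0; l]%N) //=.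
  - rewrite !big_cons big_nil add0n u0 subnKC ?un; last by rewrite /n; lia.
    move=> /(_ _)/wrap[|AlE]; first by rewrite /n; lia.
    have ulE : u l = - (P * u (n - l)%N) by lia.
    suff c0 : u (n - l)%N = 0 by rewrite ulE c0 mulr0 oppr0.
    move: sq; rewrite ulE; set c := u (n - l)%N => sq.
    have [//|c_neq0] := eqVneq c 0.
    have c_sq : 1 <= c * c by nia.
    have : P * P <= (P * P) * (c * c) by nia.
    by nia.
  - by rewrite !inE; lia.
  - by rewrite /n; lia.
  move=> i lt_in; rewrite !inE => i_s.
  have [lt_li|lt_il] := ltnP l i; first by apply: u_gt; rewrite /n; lia.
  have [eq_il|ne_il] := eqVneq (l - i)%N 1%N.
    by rewrite -[RHS]u2m; congr u; rewrite /n; lia.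
  have [||_ <-] := IHl (l - i)%N; [lia..|].
  by congr u; rewrite /n; lia.
(* Likewise [A_(m+1) = P^2] reduces to [P u_(m+1) + u_m = P^2], so [u_m] is a multiple of [P] whose
   square is less than [P^2]. *)
have [um um1] : u m = 0 /\ u m.+1 = P.
  have := sq_le [:: 0; 1; m; m.+1; n]%N; rewrite !big_cons big_nil u0 un u1.
  move=> /(_ _ _)/wrap[|| sq]; [by rewrite /= ?inE /n; lia..|].
  move: Am; rewrite (@autocorr_support _ [:: 0; m]%N) //=.
  - rewrite !big_cons big_nil add0n u0.
    have -> : (m + m.+1)%N = n by rewrite /n; lia.
    rewrite un => AmE.
    have umE : u m = P * (P - u m.+1) by nia.
    suff um1 : u m.+1 = P by rewrite umE um1 subrr mulr0.
    move: sq; rewrite umE; have [//|b_neqP] := eqVneq (u m.+1) P => sq.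
    have b_sq : 1 <= (P - u m.+1) * (P - u m.+1) by nia.
    have : P * P <= (P * P) * ((P - u m.+1) * (P - u m.+1)) by nia.
    by nia.
  - by rewrite !inE; lia.
  - by rewrite /n; lia.
  move=> i lt_in; rewrite !inE => i_s.
  have [lt_mi|lt_im] := ltnP m i; first by apply: u_gt; rewrite /n; lia.
  have [eq_im|ne_im] := eqVneq (m - i)%N 1%N.
    by rewrite -[RHS]u2m; congr u; rewrite /n; lia.
  have [|_ <-] := tails (m - i)%N; first by lia.
  by congr u; rewrite /n; lia.
split=> // i; rewrite !inE => i_s.
have [/u_gt //|le_in] := ltnP n i.
have [->//|ne_im] := eqVneq i m.
have [->//|ne_i2m] := eqVneq i m.*2.
have [lt_im|le_mi] := ltnP i m; first by have [|->] := tails i; first by lia.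
have [|_ <-] := tails (n - i)%N; first by rewrite /n; lia.
by congr u; rewrite /n; lia.
Qed.

(** * The integral multiple of [f_p] *)

Definition fpZ (m : nat) : {poly int} :=
  'X^(m.*2.+1) + m.*2.+1%:Z *: 'X^(m.+1) - 'X + m.*2.+1%:Z%:P.

Lemma coef_fpZ (m i : nat) : (0 < m)%N ->
  (fpZ m)`_i = if i == 0%N then m.*2.+1%:Z else if i == 1%N then -1 else
    if i == m.+1 then m.*2.+1%:Z else if i == m.*2.+1 then 1 else 0.
Proof.
move=> m_gt0; rewrite !coefE.
by repeat (case: eqP => ? //=); lia.
Qed.

Lemma size_fpZ (m : nat) : (0 < m)%N -> size (fpZ m) = m.*2.+2.
Proof.
move=> m_gt0; apply/eqP; rewrite eqn_leq; apply/andP; split.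
  by apply/leq_sizeP => i le_i; rewrite coef_fpZ // !ifF //; lia.
rewrite ltnNge; apply/negP => /leq_sizeP/(_ m.*2.+1 (leqnn _)).
by rewrite coef_fpZ // eqxx /= !ifF; lia.
Qed.

Lemma recip_fpZ (m : nat) : let n := m.*2.+1 in
  recip n (fpZ m) = 1 + n%:Z *: 'X^m - 'X^(m.*2) + n%:Z *: 'X^n.
Proof.
move=> n.
have -> : fpZ m = 'X^n + n%:Z *: 'X^(m.+1) + (-1) *: 'X^1 + n%:Z *: 'X^0.
  by rewrite /fpZ expr1 expr0 scaleN1r alg_polyC.
rewrite !recipD !recipZ !recipXn // /n; [|lia..].
rewrite subnn subn0 subn1 scaleN1r expr0; congr (_ + _ *: 'X^_ - _ + _).
by lia.
Qed.

Lemma autocorr_fpZ (m k : nat) : (0 < m)%N ->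
  let n := m.*2.+1 in
  autocorr n.+1 (fun i => (fpZ m)`_i) k =
    n%:Z * (fpZ m)`_k - (fpZ m)`_k.+1 + n%:Z * (fpZ m)`_(m.+1 + k)
    + (fpZ m)`_(n + k).
Proof.
move=> m_gt0 n; rewrite /autocorr.
rewrite (@sum_ord_support _ _ [:: 0; 1; m.+1; n]%N
  (fun i => (fpZ m)`_i * (fpZ m)`_(i + k))).
- rewrite !big_cons big_nil add0n add1n ![(fpZ m)`_0]coef_fpZ //.
  rewrite ![(fpZ m)`_1]coef_fpZ // ![(fpZ m)`_m.+1]coef_fpZ //.
  rewrite ![(fpZ m)`_n]coef_fpZ // /n !eqxx /= !ifF; lia.
- by rewrite /= !inE /n; lia.
- by rewrite /= /n; lia.
move=> i lt_in; rewrite !inE !negb_or => /and4P[i0 i1 im i_n].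
by rewrite coef_fpZ // !ifF ?mul0r //; exact/negbTE.
Qed.

Lemma fpZ_rigidity (m : nat) (H : {poly int}) :
    let n := m.*2.+1 in
    (0 < m)%N -> (size H <= n.+1)%N ->
    H * recip n H = fpZ m * recip n (fpZ m) -> H`_n ^+ 2 = 1 ->
  H = fpZ m \/ H = - fpZ m.
Proof.
move=> n m_gt0 sH HH Hn2; set s := H`_n in Hn2.
have ss : s * s = 1 by rewrite -expr2.
(* The sign [s] makes the leading coefficient 1 and, as [s * s = 1], leaves the autocorrelations
   unchanged. *)
pose u i := s * H`_i.
have uA k : (k <= n)%N ->
    autocorr n.+1 u k = autocorr n.+1 (fun i => (fpZ m)`_i) k.
  move=> le_kn; rewrite -coef_mul_recip ?size_fpZ // -HH coef_mul_recip //.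
  by apply: eq_bigr => i _; rewrite /u mulrACA ss mul1r.
have un : u n = 1 by [].
have u_gt i : (n < i)%N -> u i = 0.
  by move=> lt_ni; rewrite /u nth_default ?mulr0 //; apply: leq_trans lt_ni.
have u0 : u 0%N = n%:Z.
  have := uA n (leqnn n); rewrite autocorr_fpZ //.
  rewrite (@autocorr_support _ [:: 0%N]) //.
    rewrite big_seq1 add0n un mulr1 => ->.
    rewrite !coef_fpZ // /n eqxx /= !ifF; lia.
  by move=> i _; rewrite inE => i_neq0; apply: u_gt; lia.
have uE i : u i = (fpZ m)`_i.
  have [m_gt1|m_le1] := ltnP 1 m.
    have [|||k k_m|u1 um1 u_0] := @autocorr_rigidity m u m_gt1 u0 un u_gt.
    - rewrite uA // autocorr_fpZ // !addn0 !coef_fpZ // /n !eqxx /= !ifF; (lia || ring).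
    - rewrite uA ?autocorr_fpZ // /n; last by lia.
      rewrite !coef_fpZ // eqxx /= !ifF; (lia || ring).
    - rewrite uA ?autocorr_fpZ // /n.
      rewrite !coef_fpZ // !eqxx /= !ifF; (lia || ring).
    - rewrite uA ?autocorr_fpZ // /n; last by lia.
      rewrite !coef_fpZ // !ifF; lia.
    rewrite coef_fpZ //.
    case: eqP => [->//|i0]; case: eqP => [->//|i1].
    case: eqP => [->//|im]; case: eqP => [->//|i_n].
    by apply: u_0; rewrite !inE; lia.
  (* The case [p = 3] escapes the inequalities above, which need [P >= 5]; it is solved directly
     from [A_0] and [A_2]. *)
  have m1 : m = 1%N by lia.
  move: uA u0 un u_gt; rewrite /n m1 => uA u0 un u_gt.
  have [u1 u2] : u 1%N = -1 /\ u 2%N = 3.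
    have := uA 0%N isT; have := uA 2%N isT; rewrite !autocorr_fpZ //.
    rewrite !coef_fpZ //= /autocorr !big_ord_recl !big_ord0 /= /bump /= ?addn0 ?add0n u0 un.
    rewrite -![(1 + 1)%N]/2%N [u (2 + 2)%N]u_gt ?[u (1 + 2 + 2)%N]u_gt // => A2 A0.
    have u1E : u 1%N = 8 - 3 * u 2%N by lia.
    (* Eliminating [u_1] from [u_1^2 + u_2^2 = 10] leaves a quadratic in [u_2] whose other root,
       9/5, is not an integer. *)
    have : (u 2%N - 3) * (5 * u 2%N - 9) = 0 by rewrite u1E in A0; lia.
    by move/eqP; rewrite mulf_eq0 => /orP[]; lia.
  rewrite coef_fpZ //=.
  by case: i => [|[|[|[|i]]]] //=; exact: u_gt.
have HE : H = s *: fpZ m.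
  by apply/polyP => i; rewrite coefZ -uE /u mulrA ss mul1r.
have [s1|s1] : s = 1 \/ s = -1 by nia.
  by left; rewrite HE s1 scale1r.
by right; rewrite HE s1 scaleN1r.
Qed.

(** * Integral factors with constant term 1 or -1 *)

Lemma fpZ_recip_no_common_root (m : nat) (C : numDomainType) (x : C) :
    odd m -> root (map_poly intr (fpZ m)) x ->
  ~~ root (map_poly intr (recip m.*2.+1 (fpZ m))) x.
Proof.
move=> m_odd Fx; apply/negP => Fsx; move: Fx Fsx; rewrite recip_fpZ /root /fpZ.
set n := m.*2.+1.
rewrite !rmorphD !rmorphN rmorph1 /= !map_polyZ !map_polyXn map_polyX map_polyC.
rewrite !hornerE /= => /eqP Fx /eqP Fsx.
pose y := x ^+ m.
have xm1 : x ^+ m.+1 = x * y by rewrite exprS.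
have x2m : x ^+ m.*2 = y * y by rewrite -addnn exprD.
have xn : x ^+ n = x * (y * y) by rewrite exprS x2m.
rewrite xn xm1 -/y x2m in Fx Fsx.
(* This is [F(x) + x F*(x)], in which the terms without factor [n] cancel. *)
have : n%:~R * (x * y + 1) ^+ 2 = 0 :> C.
  rewrite -[RHS](addr0 0) -{1}Fx -(mulr0 x) -Fsx; ring.
move/eqP; rewrite mulf_eq0 intr_eq0 /= sqrf_eq0 addr_eq0 => /eqP xy.
have yx : y = - x.
  have : x * y * y - x + n%:~R * (x * y + 1) = 0 by rewrite -[RHS]Fx; ring.
  rewrite xy addNr mulr0 addr0 mulN1r => /eqP.
  by rewrite subr_eq0 => /eqP <-; rewrite opprK.
have x2 : x ^+ 2 = 1.
  by apply/eqP; rewrite -eqr_opp -xy yx mulrN.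
(* Since [m] is odd, [x^m] is [x] times a power of [x^2 = 1]; with [y = -x] this gives [2x = 0]. *)
have yx' : y = x.
  rewrite /y -(odd_double_half m) m_odd -muln2 mulnC exprD exprM x2 expr1n.
  by rewrite mulr1.
have /eqP : x *+ 2 = 0 by rewrite mulr2n -{1}yx' yx addNr.
rewrite mulrn_eq0 /= => /eqP x0.
by move/eqP: x2; rewrite x0 expr0n /= eq_sym oner_eq0.
Qed.

Lemma fpZ_unit_factor (m : nat) (g h : {poly int}) :
  odd m -> fpZ m = g * h -> g`_0 ^+ 2 = 1 -> size g = 1%N.
Proof.
move=> m_odd Fgh g0; have m_gt0 : (0 < m)%N by exact: odd_gt0.
set n := m.*2.+1.
have F_neq0 : fpZ m != 0 by rewrite -size_poly_eq0 size_fpZ.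
have [g_neq0 h_neq0] : g != 0 /\ h != 0.
  by apply/andP; rewrite -negb_or -mulf_eq0 -Fgh.
have sgh := size_mul g_neq0 h_neq0; rewrite -Fgh size_fpZ // in sgh.
have [a sg] : exists a, size g = a.+1.
  by exists (size g).-1; rewrite prednK // size_poly_gt0.
have [b sh] : exists b, size h = b.+1.
  by exists (size h).-1; rewrite prednK // size_poly_gt0.
have nE : n = (a + b)%N by move: sgh; rewrite sg sh /n; lia.
have recipF : recip n (fpZ m) = recip a g * recip b h.
  by rewrite nE Fgh recipM ?sg ?sh.
(* The constant term of a reciprocal is the leading coefficient, which is 1 for [fpZ m]. *)
have lead1 : g`_a * h`_b = 1.
  have := congr1 (fun q : {poly int} => q`_0) recipF.
  rewrite coef0M !coef_recip !subn0 /= => <-.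
  by rewrite coef_fpZ // /n eqxx !ifF; lia.
pose H := recip a g * h.
have recipH : recip n H = g * recip b h.
  by rewrite nE recipM ?size_recip ?sh // recipK ?sg.
have Hn : H`_n = g`_0 * h`_b.
  have := congr1 (fun q : {poly int} => q`_0) recipH.
  by rewrite coef0M !coef_recip !subn0.
have sH : (size H <= n.+1)%N.
  apply: leq_trans (size_polyMleq _ _) _; rewrite sh addnS /= nE -addSn.
  by rewrite leq_add2r size_recip.
have hb : h`_b ^+ 2 = 1.
  have /eqP : (absz (g`_a)%R * absz (h`_b)%R = 1)%N by rewrite -abszM lead1.
  by rewrite muln_eq1 => /andP[_ /eqP hb]; nia.
have HE : H = fpZ m \/ H = - fpZ m.
  apply: fpZ_rigidity => //; last by rewrite Hn exprMn g0 hb mulr1.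
  by rewrite recipH recipF Fgh /H; ring.
(* Cancel [h] in [recip a g * h = g * h] or its negative. *)
have recipg : recip a g = g \/ recip a g = - g.
  case: HE; rewrite Fgh /H => HE; [left|right]; apply: (mulIf h_neq0) => //.
  by rewrite mulNr.
(* A nonconstant [g] has a root in [algC], which is then common to [fpZ m] and its reciprocal. *)
apply/eqP; rewrite -(@size_map_inj_poly _ algC intr) //; last exact: intr_inj.
apply/negPn/negP => /closed_rootP[x gx].
have Fx : root (map_poly intr (fpZ m)) x by rewrite Fgh rmorphM /= rootM gx.
have /negP := fpZ_recip_no_common_root m_odd Fx; apply.
rewrite -/n recipF rmorphM /= rootM.
by case: recipg => ->; rewrite ?rmorphN /= ?rootN gx.
Qed.

(** * Irreducibility over the rationals *)

Unset Implicit Arguments.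

Theorem theorem1 (p : nat) (p_prime : prime p) (p_mod4 : (p = 3 %[mod 4])%N) :
  irreducible_poly (fp p).
Proof.
pose m := p./2.
have pE : p = m.*2.+1 by rewrite /m; lia.
have m_odd : odd m by rewrite /m; lia.
have m_gt0 : (0 < m)%N by exact: odd_gt0.
have p_neq0 : p%:R != 0 :> rat by rewrite pnatr_eq0; lia.
have fpE : fp p = p%:R^-1 *: map_poly intr (fpZ m).
  rewrite /fp /fpZ -pE !rmorphD !rmorphN /= map_polyZ !map_polyXn map_polyX.
  rewrite map_polyC /= (_ : (p + 1) %/ 2 = m.+1)%N; last by rewrite /m; lia.
  rewrite -[_%:P]alg_polyC !scalerDr !scalerN !scalerA mulVf // !scale1r.
  by ring.
have sZ (q : {poly int}) : size (map_poly intr q : {poly rat}) = size q.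
  by apply: size_map_inj_poly => //; exact: intr_inj.
have fp_eqp : fp p %= map_poly intr (fpZ m).
  by rewrite fpE eqp_scale // invr_eq0.
split=> [|q sq1]; first by rewrite (eqp_size fp_eqp) sZ size_fpZ.
rewrite (eqp_dvdr _ fp_eqp) (eqp_rtrans fp_eqp) => q_dvd.
(* Gauss's lemma: up to a nonzero scalar, the rational divisor [q] is an integral factor [g] of
   [fpZ m]. *)
have [g [a a_neq0 qE] [h Fgh]] := dvdpP_rat_int q_dvd.
have sqg : size q = size g by rewrite qE size_scale ?sZ.
have g0h0 : (absz (g`_0)%R * absz (h`_0)%R = p)%N.
  by rewrite -abszM -coef0M -Fgh coef_fpZ // -pE.
(* The constant terms multiply to the prime [p]. If that of [g] is a unit, [q] is constant, contrary
   to assumption; if that of [h] is, [h] is constant and [q] has full degree. *)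
have /orP[/eqP g1|/eqP h1] : (absz (g`_0)%R == 1) || (absz (h`_0)%R == 1)%N.
- have := dvdn_mulr (absz (h`_0)%R) (dvdnn (absz (g`_0)%R)); rewrite g0h0.
  move/(primeP p_prime).2/orP => [->//|/eqP g0p]; apply/orP; right.
  by move: g0h0; rewrite g0p => /eqP; rewrite -{2}[p]muln1 eqn_pmul2l //; lia.
- case/eqP: sq1; rewrite sqg; apply: (fpZ_unit_factor m_odd Fgh); nia.
rewrite -dvdp_size_eqp // sqg sZ Fgh.
have h_size : size h = 1%N.
  by apply: (@fpZ_unit_factor m h g) => //; [rewrite mulrC|nia].
have h_neq0 : h != 0 by rewrite -size_poly_eq0 h_size.
have [->|g_neq0] := eqVneq g 0; first by rewrite mul0r.
by rewrite size_mul // h_size addn1.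
Qed.
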